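(* Let $m$, $k$, and $N$ be integers such that $e_w u_{2km}\neq 0$ and such that all Horadam numbers occurring in denominators below are nonzero. Then $$\sum_{i = 1}^N \frac{q^{m(i - k)}}{w_{m(i - k)}\, w_{m(i + k)}} = \frac{1}{e_w u_{2km}}\sum_{i = 1}^{2k} \left( \frac{w_{m(i + N - k) + 1}}{w_{m(i + N - k)}} - \frac{w_{m(i - k) + 1}}{w_{m(i - k)}}\right)$$ or, equivalently, $$u_{2km}\sum_{i = 1}^N \frac{q^{mi}}{w_{m(i - k)}\, w_{m(i + k)}} = u_{mN}\sum_{i = 1}^{2k} \frac{q^{mi}}{w_{m(i - k)}\, w_{m(i+N-k)}}.$$
   Context: Let $a,b,p,q$ be complex numbers with $q\neq 0$. The Horadam sequence $(w_n)_{n\in\mathbb{Z}}=(w_n(a,b;p,q))_{n\in\mathbb{Z}}$ is defined by $w_0=a$, $w_1=b$, $w_n=pw_{n-1}-qw_{n-2}$, extended by the same recurrence to all integer indices. Put $u_n=w_n(0,1;p,q)$. Let $\alpha,\beta$ be the roots of $x^2-px+q=0$; they are assumed distinct, i.e. $\Delta=p^2-4q\neq 0$, with $|\alpha|>|\beta|$. For all $n\in\mathbb{Z}$, $w_n=\frac{A\alpha^n-B\beta^n}{\alpha-\beta}$ with $A=b-a\beta$, $B=b-a\alpha$, and $u_n=\frac{\alpha^n-\beta^n}{\alpha-\beta}$. Put $e_w=-AB=pab-qa^2-b^2$. Summation convention for an integer upper limit $M\le 0$: $\sum_{i=1}^{0}g(i)=0$ and $\sum_{i=1}^{M}g(i)=-\sum_{i=M+1}^{0}g(i)$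 for $M<0$. *)

(* Defs.v *)
From mathcomp Require Import all_boot all_order all_algebra ring.

Set Implicit Arguments.
Unset Strict Implicit.
Unset Printing Implicit Defensive.

Import GRing.Theory.
Local Open Scope ring_scope.

Fixpoint horadam_nat (F : fieldType) (a b p q : F) (n : nat) : F :=
  match n with
  | 0%N => a
  | n1.+1 => match n1 with
             | 0%N => b
             | n2.+1 => p * horadam_nat a b p q n1 - q * horadam_nat a b p q n2
             end
  end.

(* Running the recurrence backwards, v_n = w_(-n) satisfies                   *)
(* v_n = (p / q) v_(n-1) - q^-1 v_(n-2), with v_0 = a, v_1 = (p a - b) / q;    *)
(* recall that Negz n is - n.+1. See horadam_rec.                             *)
Definition horadam (F : fieldType) (a b p q : F) (n : int) : F :=
  match n with
  | Posz n => horadam_nat a b p q n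
  | Negz n => horadam_nat a ((p * a - b) / q) (p / q) q^-1 n.+1
  end.

Lemma horadam0 (F : fieldType) (a b p q : F) : horadam a b p q 0 = a.
Proof. by []. Qed.

Lemma horadam1 (F : fieldType) (a b p q : F) : horadam a b p q 1 = b.
Proof. by []. Qed.

Lemma horadam_rec (F : fieldType) (a b p q : F) (n : int) : q != 0 ->
  horadam a b p q n =
    p * horadam a b p q (n - 1) - q * horadam a b p q (n - 2).
Proof.
move=> q0; case: n => [[|[|n]]|n].
- by rewrite /horadam /=; field.
- by rewrite /horadam /=; field.
- have -> : Posz n.+2 - 1 = Posz n.+1 by rewrite -(addn1 n.+1) PoszD addrK.
  by have -> : Posz n.+2 - 2 = Posz n by rewrite -(addn2 n) PoszD addrK.
- have -> : Negz n - 1 = Negz n.+1 by rewrite !NegzE -opprD -PoszD addn1.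
  have -> : Negz n - 2 = Negz n.+2 by rewrite !NegzE -opprD -PoszD addn2.
  by rewrite /horadam /=; field.
Qed.

Definition horadam_u (F : fieldType) (p q : F) (n : int) : F :=
  horadam 0 1 p q n.

(* e_w = - A B, where A and B are the Binet coefficients of w. *)
Definition horadam_e (F : fieldType) (a b alpha beta : F) : F :=
  - ((b - a * beta) * (b - a * alpha)).

Lemma horadam_eE (F : fieldType) (a b alpha beta : F) :
  horadam_e a b alpha beta =
    (alpha + beta) * a * b - (alpha * beta) * a ^+ 2 - b ^+ 2.
Proof. by rewrite /horadam_e; ring. Qed.

(* The sum of g i for i = 1 .. M, with an integer upper limit: for M < 0 it   *)
(* is the opposite of the sum of g i for i = M + 1 .. 0. If M = Negz n, then  *)
(* M + 1 = - n.                                                               *)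
Definition sumz (V : zmodType) (M : int) (g : int -> V) : V :=
  match M with
  | Posz n => \sum_(1 <= i < n.+1) g i%:Z
  | Negz n => - \sum_(0 <= i < n.+1) g (- i%:Z)
  end.

(* The indices i of the terms that occur in sumz M g. *)
Definition sumz_index (M i : int) : bool :=
  (1 <= i <= M) || (M + 1 <= i <= 0).

(* Main.v *)
(* With r_n = w_(n+1) / w_n, d'Ocagne's identity reads
   r_(n+j) - r_n = e_w u_j q^n / (w_n w_(n+j)). Up to constants, the summands
   are therefore differences of f(i) = r_(m(i-k)), with step 2k in the sums up
   to N and with step N in the sums up to 2k, and the two sums of differences
   f(i+K) - f(i), i <= M, and f(i+M) - f(i), i <= K, coincide by telescoping. *)

Require Import Defs.
From mathcomp Require Import all_boot all_order all_algebra zify ring.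
From mathcomp Require Import reals complex.

Set Implicit Arguments.
Unset Strict Implicit.
Unset Printing Implicit Defensive.

Import Order.TTheory GRing.Theory Num.Theory.
Local Open Scope ring_scope.

Section SumZ.
Variable V : zmodType.
Implicit Types (g h : int -> V) (M K : int).

Lemma sumzS M g : sumz (M + 1) g = sumz M g + g (M + 1).
Proof.
case: M => [n|[|n]].
- by rewrite -PoszD addn1 /= big_nat_recr.
(* Here [M] is -1: the left side is empty, and on the right [- g 0] cancels [g 0]. *)
- by rewrite /= big_nil big_nat1 oppr0 addNr.
- have -> : Negz n.+1 + 1 = Negz n by lia.
  by rewrite /= [in RHS]big_nat_recr //= opprD addrNK.
Qed.

(** The sign convention for negative limits makes this hold for all signs of [M] and [K]; the
    induction on [K] runs in both directions. *)
Lemma sumzD M K g : sumz (M + K) g = sumz M g + sumz K (fun i => g (M + i)).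
Proof.
elim: K => [|n IH|n IH].
- by rewrite addr0 /= big_nil addr0.
- by rewrite -addn1 PoszD addrA !sumzS IH !addrA.
(* Downward step: [sumzS] splits the same last term off both sides of the induction hypothesis, and
   it cancels. *)
- have e : - n%:Z = - n.+1%:Z + 1 by lia.
  move: IH; rewrite e addrA !sumzS addrA -[M + _ + 1]addrA.
  by move/addIr.
Qed.

(** Only the indices that occur matter, since denominators are known to be nonzero only there. *)
Lemma eq_sumz M g h :
  (forall i, sumz_index M i -> g i = h i) -> sumz M g = sumz M h.
Proof.
rewrite /sumz_index; case: M => n gh /=.
  by apply: eq_big_nat => i i_n; apply: gh; lia.
by congr (- _); apply: eq_big_nat => i i_n; apply: gh; lia.
Qed.

Lemma sumzB M g h : sumz M (fun i => g i - h i) = sumz M g - sumz M h.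
Proof. by case: M => n /=; rewrite sumrB ?opprD. Qed.

(* Both sides are the sum over 1 .. M + K minus those over 1 .. M and 1 .. K. *)
Lemma sumz_shiftC M K g :
  sumz M (fun i => g (i + K) - g i) = sumz K (fun i => g (i + M) - g i).
Proof.
have shiftE L L' : sumz L (fun i => g (i + L') - g i)
    = sumz (L' + L) g - sumz L' g - sumz L g.
  rewrite sumzB sumzD [sumz L' g + _]addrC addrK; congr (_ - _).
  by apply: eq_sumz => i _; rewrite addrC.
by rewrite !shiftE addrAC [K + M]addrC.
Qed.

End SumZ.

Lemma mulr_sumz (F : pzRingType) (c : F) (M : int) (g : int -> F) :
  c * sumz M g = sumz M (fun i => c * g i).
Proof. by case: M => n /=; rewrite ?mulrN mulr_sumr. Qed.

(** Vieta: the difference of the two equations is [(x - y) * (x + y - p) = 0], which gives [p]; the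
    equation at [x] then gives [q]. *)
Lemma root_quadratic_coef (F : fieldType) (p q x y : F) : x != y ->
  root ('X^2 - p *: 'X + q%:P) x -> root ('X^2 - p *: 'X + q%:P) y ->
  p = x + y /\ q = x * y.
Proof.
rewrite /root !hornerE => xy /eqP ex /eqP ey.
have pE : p = x + y.
  have : (x - y) * (x + y - p) = 0.
    by transitivity ((x ^+ 2 - p * x + q) - (y ^+ 2 - p * y + q));
       [ring | rewrite ex ey subrr].
  move/eqP; rewrite mulf_eq0 subr_eq0 (negPf xy) subr_eq0 /=.
  by move/eqP.
split=> //; apply/eqP; rewrite -subr_eq0 -[X in _ == X]ex pE.
by apply/eqP; ring.
Qed.

Section Horadam.
Variables (F : fieldType) (alpha beta : F).
Hypotheses (alpha_neq0 : alpha != 0) (beta_neq0 : beta != 0).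
Hypothesis alpha_neq_beta : alpha != beta.
Let p := alpha + beta.
Let q := alpha * beta.

Lemma horadam_binet (a b : F) (n : int) :
  horadam a b p q n =
    ((b - a * beta) * alpha ^ n - (b - a * alpha) * beta ^ n) / (alpha - beta).
Proof.
set w := horadam a b p q; have d0 : alpha - beta != 0 by rewrite subr_eq0.
have q0 : q != 0 by rewrite mulf_neq0.
pose v i := ((b - a * beta) * alpha ^ i - (b - a * alpha) * beta ^ i)
            / (alpha - beta).
have vS i : v (i + 2) = p * v (i + 1) - q * v i.
  by rewrite /v /p /q !expfzDr // -!exprnP; field.
have wS i : w (i + 2) = p * w (i + 1) - q * w i.
  by rewrite [LHS]horadam_rec // addrK -addrA.
(* The recurrence has order two, so the induction carries two consecutive values. *)
suff [] : w n = v n /\ w (n + 1) = v (n + 1) by [].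
elim: n => [|n [e0 e1]|n [e0 e1]].
- by rewrite /v add0r !expr0z !expr1z; split; rewrite /w /horadam /=; field.
- have e : n.+1%:Z = n%:Z + 1 by lia.
  by rewrite e e1 -addrA wS vS e0 e1.
(* Going down, the recurrence determines [q] times the earlier value, and [q] is cancelled. *)
- have e : - n%:Z = - n.+1%:Z + 1 by lia.
  rewrite e in e0 e1; split=> //; apply: (mulfI q0).
  by move: e1; rewrite -addrA wS vS e0 => /addrI/oppr_inj.
Qed.

(** By Binet, the pure powers of [alpha] and of [beta] cancel, and each cross term contains the
    factor [(alpha * beta) ^ n]. *)
Lemma horadam_docagne (a b : F) (n j : int) :
  let w := horadam a b p q in
  w (n + j + 1) * w n - w (n + 1) * w (n + j) =
    horadam_e a b alpha beta * horadam_u p q j * q ^ n.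
Proof.
move=> w; have d0 : alpha - beta != 0 by rewrite subr_eq0.
rewrite /w /horadam_u !horadam_binet // /horadam_e /q expfzMl.
by rewrite !expfzDr // !expr1z; field.
Qed.

(** D'Ocagne's identity divided by [w n * w n']. The index [n'] is kept separate so that
    [m * (i + k)] fits without being rewritten as a sum. *)
Lemma horadam_ratioB (a b : F) (n n' j : int) :
  let w := horadam a b p q in
  n' = n + j -> w n != 0 -> w n' != 0 ->
  w (n' + 1) / w n' - w (n + 1) / w n =
    horadam_e a b alpha beta * horadam_u p q j * (q ^ n / (w n * w n')).
Proof.
move=> w -> wn wnj; rewrite mulrA -horadam_docagne.
by rewrite -/w; field; rewrite wn wnj.
Qed.

End Horadam.

Theorem theorem5 (R : realType) (a b p q alpha beta : R[i]) (m k N : int)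
  (q_neq0 : q != 0)
  (alpha_root : root ('X^2 - p *: 'X + q%:P) alpha)
  (beta_root : root ('X^2 - p *: 'X + q%:P) beta)
  (Delta_neq0 : p ^+ 2 - 4%:R * q != 0)
  (beta_lt_alpha : `|beta| < `|alpha|) :
  let w := horadam a b p q in
  let u := horadam_u p q in
  let e_w := horadam_e a b alpha beta in
  e_w * u (2 * k * m) != 0 ->
  (forall i : int, sumz_index N i ->
     w (m * (i - k)) != 0 /\ w (m * (i + k)) != 0) ->
  (forall i : int, sumz_index (2 * k) i ->
     w (m * (i + N - k)) != 0 /\ w (m * (i - k)) != 0) ->
  sumz N (fun i => q ^ (m * (i - k)) / (w (m * (i - k)) * w (m * (i + k))))
    = (e_w * u (2 * k * m))^-1 *
      sumz (2 * k) (fun i =>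
        w (m * (i + N - k) + 1) / w (m * (i + N - k))
        - w (m * (i - k) + 1) / w (m * (i - k)))
  /\
  u (2 * k * m) *
    sumz N (fun i => q ^ (m * i) / (w (m * (i - k)) * w (m * (i + k))))
    = u (m * N) *
      sumz (2 * k) (fun i =>
        q ^ (m * i) / (w (m * (i - k)) * w (m * (i + N - k)))).
Proof.
have ab : alpha != beta by apply: contraTneq beta_lt_alpha => ->; rewrite ltxx.
have [pE qE] := root_quadratic_coef ab alpha_root beta_root.
move=> w u e_w eu0 wN wk.
have e0 : e_w != 0 by move: eu0; rewrite mulf_eq0 negb_or => /andP[].
have /andP[al0 be0] : (alpha != 0) && (beta != 0).
  by move: q_neq0; rewrite qE mulf_eq0 negb_or.
have ratioB n n' j : n' = n + j -> w n != 0 -> w n' != 0 ->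
    w (n' + 1) / w n' - w (n + 1) / w n = e_w * u j * (q ^ n / (w n * w n')).
  rewrite /w /u /e_w pE qE; exact: horadam_ratioB.
pose f (i : int) := w (m * (i - k) + 1) / w (m * (i - k)).
(* The indices [m * (i - k)] and [m * (i + k)] differ by [2 * k * m]. *)
have sumN : e_w * u (2 * k * m) *
    sumz N (fun i => q ^ (m * (i - k)) / (w (m * (i - k)) * w (m * (i + k))))
    = sumz N (fun i => f (i + 2 * k) - f i).
  rewrite mulr_sumz; apply: eq_sumz => i /wN[w1 w2].
  have E : i + 2 * k - k = i + k by ring.
  by rewrite /f E (ratioB _ _ (2 * k * m)) //; ring.
(* Here the index gap is [m * N]. *)
have sumk : e_w * u (m * N) * sumz (2 * k) (fun i =>
      q ^ (m * (i - k)) / (w (m * (i - k)) * w (m * (i + N - k))))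
    = sumz (2 * k) (fun i => f (i + N) - f i).
  rewrite mulr_sumz; apply: eq_sumz => i /wk[w1 w2].
  by rewrite /f (ratioB _ _ (m * N)) //; ring.
split; first by rewrite -[X in _ * X]sumz_shiftC -sumN mulKf.
(* The factor [q ^ (m * k)] does not depend on [i], so it comes out of both sums of the second
   identity. Multiplying what remains by [e_w] gives the two telescoping sums. *)
have scale M (c : int -> R[i]) : sumz M (fun i => q ^ (m * i) / c i)
    = q ^ (m * k) * sumz M (fun i => q ^ (m * (i - k)) / c i).
  rewrite mulr_sumz; apply: eq_sumz => i _.
  by rewrite mulrA -expfzDr // -mulrDr addrC subrK.
rewrite !scale !(mulrCA (u _)); congr (_ * _); apply: (mulfI e0).
by rewrite !mulrA sumN sumk sumz_shiftC.
Qed.
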